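(* Let $k, s \in \mathbb{N}$ with $k \ge 2$ and $s \ge 2k^2$. For every $\gamma > 0$ there exists $n_0 = n_0(k,s,\gamma)$ such that for all $n \ge n_0$, \[ c_{k-1}(n, C^k_s) \le \left(\tfrac12 + \gamma\right) n. \] Equivalently: every $k$-uniform hypergraph $H$ on $n \ge n_0$ vertices with $\delta_{k-1}(H) > (1/2+\gamma)n$ has the property that every vertex of $H$ lies in a copy of $C^k_s$.
   Context: A $k$-graph is a $k$-uniform hypergraph. For a $k$-graph $H$ and $0\le i<k$, $\delta_i(H)$ is the minimum, over all $i$-element vertex sets $S$, of the number of edges of $H$ containing $S$; $\delta_{k-1}(H)$ is the minimum codegree. For $s \ge k$, the tight cycle $C^k_s$ is the $k$-graph on $s$ vertices admitting a cyclic ordering of its vertices such that every $k$ consecutive vertices (cyclically) form an edge, and whose edges are exactly these. For a $k$-graph $F$, a $k$-graph $H$ has an $F$-covering if every vertex of $H$ is contained in a copy of $F$ in $H$. The covering threshold $c_{i}(n,F)$ is the maximum of $\delta_i(H)$ over all $k$-graphs $H$ on $n$ vertices that do not have an $F$-covering. *)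

(* Defs.v *)
From HB Require Import structures.
From mathcomp Require Import all_boot all_order all_algebra.
From mathcomp Require Import reals.

Set Implicit Arguments.
Unset Strict Implicit.
Unset Printing Implicit Defensive.

(* A hypergraph on the vertex type T is given by its edge set. *)
Definition is_kgraph (k : nat) (T : finType) (H : {set {set T}}) : bool :=
  [forall e in H, #|e| == k].

Definition degree (T : finType) (H : {set {set T}}) (S : {set T}) : nat :=
  #|[set e in H | S \subset e]|.

(* Every degree is at most #|H|, so the default value #|H| does not affect the
   minimum as soon as T has an i-element subset. *)
Definition min_degree (i : nat) (T : finType) (H : {set {set T}}) : nat :=
  \big[minn/#|H|]_(S : {set T} | #|S| == i) degree H S.

Definition tight_cycle (k s : nat) : {set {set 'I_s}} :=
  [set [set j : 'I_s | [exists t : 'I_k, j == (i + t) %% s :> nat]] | i : 'I_s].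

(* f embeds F as a (not necessarily induced) subgraph of H. *)
Definition is_copy (U T : finType) (F : {set {set U}}) (H : {set {set T}})
    (f : {ffun U -> T}) : bool :=
  injectiveb f && [forall e in F, f @: e \in H].

Definition in_copy (U T : finType) (F : {set {set U}}) (H : {set {set T}})
    (v : T) : bool :=
  [exists f : {ffun U -> T}, is_copy F H f && (v \in codom f)].

Definition has_covering (U T : finType) (F : {set {set U}})
    (H : {set {set T}}) : bool :=
  [forall v : T, in_copy F H v].

(* The maximum of an empty family is 0: this occurs only when every k-graph on
   n vertices has an F-covering. *)
Definition covering_threshold (k i n : nat) (U : finType)
    (F : {set {set U}}) : nat :=
  \max_(H : {set {set 'I_n}} | is_kgraph k H && ~~ has_covering F H)
     min_degree i H.

(* Main.v *)
Require Import Defs.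
From HB Require Import structures.
From mathcomp Require Import all_boot all_order all_algebra all_fingroup.
From mathcomp Require Import reals zify lra.

Set Implicit Arguments.
Unset Strict Implicit.
Unset Printing Implicit Defensive.

(* Write k = K + 1 and fix the vertex v to be covered.  A gadget at v consists of
   an edge {x_0, ..., x_K} such that {v, x_1, ..., x_K} is also an edge, and, for
   all indices a, b, a vertex w_(a,b) that completes to an edge both
   {x_u : u <> a} and {x_u : u <> b}.  As any two K-sets have at least 2 gamma n
   common neighbours, choosing the vertices one by one gives a positive density of
   gadgets; hence, as in Erdos' theorem on complete partite hypergraphs, there are
   disjoint classes of size s, one for each vertex of the gadget, all of whose
   transversals are gadgets.
   In such a blow-up a tight walk running cyclically through the classes
   x_0, ..., x_K can exchange the positions of x_a and x_b by using w_(a,b) once,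
   at a cost of two rounds: w_(a,b) replaces x_a, then x_a replaces x_b, then x_b
   replaces w_(a,b).  Every rotation is a product of at most K transpositions, so
   2 K rounds rotate the cyclic order by any prescribed amount, and the walk closes
   up after s steps for every s >= 2 k^2.  The vertex v takes the place of one
   vertex of the class x_0. *)

(** * Boxes in dense sets of functions, and greedy counting *)

Lemma exists_subset_card (T : finType) (B : {set T}) (m : nat) :
  m <= #|B| -> exists2 V : {set T}, V \subset B & #|V| = m.
Proof.
case/card_geqP=> r [ur sr rB]; exists [set x in r].
  by apply/subsetP=> x; rewrite inE => /rB.
by rewrite cardsE (card_uniqP ur).
Qed.

(** Fix [M] rows of density at least [1/(2q)]. A column meets [2t] of them on average, so a [1/(4q)]
    share of the columns meets at least [t]. Each such column contains some [t]-subset of these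
    rows, and pigeonhole over at most [2^M] subsets yields [P]. *)
Lemma dense_rel_rectangle (q t : nat) : 0 < q -> 0 < t ->
  exists q' N : nat, 0 < q' /\
    forall (T X : finType) (A : T -> X -> bool), N <= #|T| ->
      #|T| * #|X| <= q * \sum_a \sum_z A a z ->
      exists (P : {set T}) (Z : {set X}),
        [/\ #|P| = t, #|X| <= q' * #|Z| &
            forall a z, a \in P -> z \in Z -> A a z].
Proof.
move=> q0 t0; pose M := 4 * q * t.
have M0 : 0 < M by rewrite !muln_gt0 q0 t0.
exists (4 * q * 2 ^ M), (2 * q * M); split; first by rewrite !muln_gt0 q0 expn_gt0.
move=> T X A nT dA; set n := #|X| in dA *.
pose deg a := \sum_z A a z.
have degn a : deg a <= n.
  by rewrite /deg /n -sum1_card; apply: leq_sum => z _; case: (A a z).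
pose B := [set a | n <= 2 * q * deg a].
have MB : M <= #|B|.
  have [n0|n_gt0] := posnP n.
    have -> : B = [set: T] by apply/setP=> a; rewrite !inE n0.
    by rewrite cardsT; apply: leq_trans nT; nia.
  have dB : 2 * q * \sum_a deg a <= 2 * q * n * #|B| + #|T| * n.
    rewrite big_distrr /= (bigID (mem B)) /=; apply: leq_add.
      rewrite [X in _ <= X]mulnC -sum_nat_const; apply: leq_sum => a _.
      by rewrite leq_mul2l degn orbT.
    apply: (@leq_trans (\sum_(a in ~: B) n)).
      rewrite [X in _ <= X](eq_bigl (fun a => a \notin B)); last by move=> a; rewrite !inE.
      by apply: leq_sum => a; rewrite inE -ltnNge => /ltnW.
    by rewrite sum_nat_const leq_mul2r max_card orbT.
  have dA' : #|T| * n <= q * \sum_a deg a := dA.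
  have h : #|T| * n <= (2 * q * #|B|) * n by rewrite -!mulnA in dA' dB *; lia.
  rewrite leq_pmul2r // in h.
  by rewrite -(@leq_pmul2l (2 * q)) ?muln_gt0 ?q0 //; exact: leq_trans nT h.
have [V /subsetP sVB cV] := exists_subset_card MB.
pose N z := [set a in V | A a z].
pose Z := [set z | t <= #|N z|].
have sN : \sum_z #|N z| = \sum_(a in V) deg a.
  rewrite /deg exchange_big /=; apply: eq_bigr => z _.
  rewrite -sum1_card big_mkcond [RHS]big_mkcond /=; apply: eq_bigr => a _.
  by rewrite inE; case: (a \in V); case: (A a z).
have lowN : M * n <= 2 * q * \sum_z #|N z|.
  rewrite sN big_distrr /= -cV -sum_nat_const.
  by apply: leq_sum => a /sVB; rewrite inE.
have upN : \sum_z #|N z| <= #|Z| * M + n * t.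
  rewrite (bigID (mem Z)) /=; apply: leq_add.
    rewrite -sum_nat_const; apply: leq_sum => z _; rewrite -cV.
    by apply/subset_leq_card/subsetP=> a; rewrite inE => /andP[].
  apply: (@leq_trans (\sum_(z in ~: Z) t)).
    rewrite [X in _ <= X](eq_bigl (fun a => a \notin Z)); last by move=> a; rewrite !inE.
    by apply: leq_sum => a; rewrite inE -ltnNge => /ltnW.
  by rewrite sum_nat_const leq_mul2r max_card orbT.
have bigZ : n <= 4 * q * #|Z|.
  have h : M * n <= 2 * q * (#|Z| * M + n * t) by apply: leq_trans lowN _; rewrite leq_mul2l upN orbT.
  have : t * n * (2 * q) <= 2 * q * #|Z| * (4 * q * t) by rewrite /M in h; nia.
  have qt : 0 < 2 * q * t by rewrite !muln_gt0 q0.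
  have -> : 2 * q * #|Z| * (4 * q * t) = (4 * q * #|Z|) * (2 * q * t) by nia.
  have -> : t * n * (2 * q) = n * (2 * q * t) by nia.
  by rewrite leq_pmul2r.
pose ZP (P : {set T}) := [set z | P \subset N z].
pose F := [set P : {set T} | (P \subset V) && (#|P| == t)].
have [|noP] := boolP [exists P in F, #|Z| <= 2 ^ M * #|ZP P|].
  case/exists_inP => P; rewrite inE => /andP[_ /eqP cP] bP.
  exists P, (ZP P); split=> //.
    by apply: leq_trans bigZ _; rewrite -!mulnA !leq_mul2l bP !orbT.
  by move=> a z aP; rewrite inE => /subsetP/(_ a aP); rewrite inE => /andP[].
exfalso.
have cF : #|F| <= 2 ^ M.
  rewrite -cV -card_powerset; apply/subset_leq_card/subsetP=> P.
  by rewrite !inE => /andP[].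
have sZ : #|Z| <= \sum_(P in F) #|ZP P|.
  have -> : \sum_(P in F) #|ZP P| = \sum_z \sum_(P in F) (z \in ZP P).
    rewrite exchange_big /=; apply: eq_bigr => P _.
    by rewrite -sum1_card big_mkcond; apply: eq_bigr => z _; case: (z \in ZP P).
  rewrite -sum1_card big_mkcond /=; apply: leq_sum => z _.
  case: ifP => //; rewrite inE => /exists_subset_card[P sP cP].
  have PF : P \in F.
    rewrite inE cP eqxx andbT; apply: subset_trans sP _.
    by apply/subsetP=> a; rewrite inE => /andP[].
  by rewrite (bigD1 P) //= inE sP.
(* The strict bound by [#|Z|.-1] below needs [Z] nonempty; for empty [Z] any [t]-subset of [V]
   satisfies the inequality. *)
have [Z0|Z_gt0] := posnP #|Z|.
  have [P sP cP] := @exists_subset_card T V t ltac:(rewrite cV /M; nia).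
  case/exists_inP: noP; exists P; last by rewrite Z0.
  by rewrite inE sP cP eqxx.
have: 2 ^ M * #|Z| <= #|F| * #|Z|.-1.
  apply: leq_trans (leq_mul (leqnn _) sZ) _.
  rewrite big_distrr /= -sum_nat_const; apply: leq_sum => P PF.
  rewrite leqNgt; apply: contra noP => h; apply/exists_inP; exists P => //.
  by rewrite -(prednK Z_gt0).
by have := expn_gt0 2 M; nia.
Qed.

Definition upd (L T : finType) (phi : {ffun L -> T}) (l : L) (a : T) :
  {ffun L -> T} := [ffun l' => if l' == l then a else phi l'].

Lemma updT (L T : finType) (phi : {ffun L -> T}) l a : upd phi l a l = a.
Proof. by rewrite ffunE eqxx. Qed.

Lemma updF (L T : finType) (phi : {ffun L -> T}) l a l' :
  l' != l -> upd phi l a l' = phi l'.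
Proof. by rewrite ffunE => /negbTE->. Qed.

(* [(a, phi) |-> (phi l, upd phi l a)] is an involution. *)
Lemma sum_upd (L T : finType) (Z : {set {ffun L -> T}}) (l : L) :
  \sum_a \sum_(phi : {ffun L -> T}) (upd phi l a \in Z) = #|T| * #|Z|.
Proof.
pose sw (x : T * {ffun L -> T}) := (x.2 l, upd x.2 l x.1).
have swK : involutive sw.
  case=> a phi; rewrite /sw /= updT; congr (_, _); apply/ffunP=> l'.
  by rewrite !ffunE; case: eqP => [->|].
rewrite pair_big /= (reindex_inj (inv_inj swK)) /=.
rewrite (eq_bigr (fun x : T * {ffun L -> T} => (x.2 \in Z) : nat)); last first.
  by move=> x _; rewrite -[in RHS](swK x).
rewrite -(pair_big xpredT xpredT (fun _ phi => (phi \in Z) : nat)) /=.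
rewrite sum_nat_const; congr (_ * _).
by rewrite -sum1_card [RHS]big_mkcond; apply: eq_bigr => z _; case: (z \in Z).
Qed.

(** Induction on the list of freed coordinates, pairing a value at [l] with a whole function.
    Functions are overwritten at [l] rather than restricted, so their type never changes; [phi]
    fixes the coordinates outside [r]. *)
Lemma dense_ffun_partial_box (L : finType) (t : nat) (r : seq L) (q : nat) :
  0 < q -> 0 < t -> uniq r ->
  exists N : nat, forall (T : finType) (Z : {set {ffun L -> T}}),
    0 < #|T| -> N <= #|T| -> #|{ffun L -> T}| <= q * #|Z| ->
    exists (S : L -> {set T}) (phi : {ffun L -> T}),
      (forall l, l \in r -> #|S l| = t) /\
      forall psi : {ffun L -> T},
        (forall l, if l \in r then psi l \in S l else psi l == phi l) ->
        psi \in Z.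
Proof.
move=> q0 t0; elim: r q q0 => [|l r IH] q q0 /=.
  exists 0 => T Z T0 _ qZ; exists (fun=> set0).
  have : 0 < #|Z|.
    have : 0 < #|{ffun L -> T}| by rewrite card_ffun expn_gt0 T0.
    by move=> /leq_trans/(_ qZ); rewrite muln_gt0 => /andP[].
  case/card_gt0P => phi phiZ; exists phi; split=> // psi h.
  by have -> : psi = phi by apply/ffunP=> l; apply/eqP; exact: h.
case/andP=> lr ur.
have [q' [N1 [q'0 step]]] := dense_rel_rectangle q0 t0.
have [N2 {}IH] := IH _ q'0 ur.
exists (maxn N1 N2) => T Z T0; rewrite geq_max => /andP[n1 n2] qZ.
have [||P [Z' [cP qZ' PZ]]] := step T {ffun L -> T} (fun a phi => upd phi l a \in Z).
- by [].
- by rewrite sum_upd mulnCA leq_mul2l qZ orbT.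
have [S [phi [cS hS]]] := IH T Z' T0 n2 qZ'.
exists (fun l' => if l' == l then P else S l'), phi; split.
  by move=> l'; rewrite inE; case: eqP => //= _; apply: cS.
move=> psi h.
(* The inner update takes the value [phi l] that the induction hypothesis demands at [l], which is
   outside [r]; the outer one restores [psi]. *)
have -> : psi = upd (upd psi l (phi l)) l (psi l).
  by apply/ffunP=> l'; rewrite !ffunE; case: eqP => [->|].
apply: PZ; first by have := h l; rewrite inE eqxx.
apply: hS => l'; have := h l'; rewrite inE ffunE.
by case: eqP => [->|//] /=; rewrite (negbTE lr) eqxx.
Qed.

Lemma dense_ffun_box (L : finType) (t q : nat) : 0 < q -> 0 < t ->
  exists N : nat, forall (T : finType) (A : {set {ffun L -> T}}),
    0 < #|T| -> N <= #|T| -> #|{ffun L -> T}| <= q * #|A| ->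
    exists S : L -> {set T}, (forall l, #|S l| = t) /\
      forall psi : {ffun L -> T}, (forall l, psi l \in S l) -> psi \in A.
Proof.
move=> q0 t0.
have [N h] := dense_ffun_partial_box q0 t0 (enum_uniq L).
exists N => T A T0 nT qA; have [S [phi [cS hS]]] := h T A T0 nT qA.
exists S; split=> [l|psi hpsi]; first by rewrite cS ?mem_enum ?inE.
by apply: hS => l; rewrite mem_enum; apply: hpsi.
Qed.

(** Values are chosen in order of rank. Each stage keeps at least a [1/q] share of the functions,
    because the admissible set depends on earlier values only and is large once these are
    admissible. *)
Lemma greedy_count (L T : finType) (rk : L -> nat)
    (N : L -> {ffun L -> T} -> {set T}) (q : nat) :
  0 < #|T| -> 0 < q -> injective rk ->
  (forall l (phi psi : {ffun L -> T}), (forall l', rk l' < rk l -> phi l' = psi l') ->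
     N l phi = N l psi) ->
  (forall l (phi : {ffun L -> T}), (forall l', rk l' < rk l -> phi l' \in N l' phi) ->
     #|T| <= q * #|N l phi|) ->
  forall j, #|{ffun L -> T}| <=
    q ^ j * #|[set phi : {ffun L -> T} | [forall l, (rk l < j) ==> (phi l \in N l phi)]]|.
Proof.
move=> T0 q0 rk_inj Nloc Nbig; elim=> [|j IH].
  rewrite mul1n (_ : [set _ | _] = setT) ?cardsT //.
  by apply/setP=> phi; rewrite !inE; apply/forallP=> l.
apply: leq_trans IH _; rewrite expnSr -mulnA leq_mul2l; apply/orP; right.
set B := [set _ | _]; set C := [set _ | _].
have [[l /eqP rl]|nol] := altP (@existsP _ (fun l => rk l == j)); last first.
  have -> : C = B.
    apply/setP=> phi; rewrite !inE; apply: eq_forallb => l.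
    rewrite ltnS leq_eqVlt; case: eqP => //= rl.
    by case/existsP: nol; exists l; apply/eqP.
  by rewrite -{1}[#|B|]mul1n leq_mul2r q0 orbT.
(* After multiplying by [#|T|], count pairs [(a, phi)] with [upd phi l a] in [C]: every [phi] in [B]
   contributes at least [#|N l phi|] of them. *)
rewrite -(leq_pmul2l T0) mulnCA -(sum_upd C l) exchange_big /=.
rewrite mulnC -sum_nat_const big_distrr /= [X in _ <= X](bigID (mem B)) /=.
apply: leq_trans (leq_addr _ _); apply: leq_sum => phi; rewrite inE => /forallP phiB.
have loc a l' : rk l' <= j -> N l' (upd phi l a) = N l' phi.
  move=> rl'; apply: Nloc => l'' rl''; apply: updF; apply: contraTneq rl'' => ->.
  by rewrite -leqNgt rl.
apply: leq_trans (Nbig l phi _) _.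
  by move=> l'; rewrite rl; exact/implyP.
rewrite leq_mul2l -sum1_card big_mkcond /=; apply/orP; right.
apply: leq_sum => a _; case: ifP => // aN.
rewrite lt0b inE; apply/forallP=> l'; apply/implyP; rewrite ltnS => rl'.
rewrite loc //; have [->|ne] := eqVneq l' l; first by rewrite updT.
rewrite updF //; apply: (implyP (phiB l')); rewrite ltn_neqAle rl' andbT.
by apply: contra ne => /eqP e; apply/eqP/rk_inj; rewrite rl.
Qed.

(** * A word of labels that permutes the cyclic order *)

Section RotationWord.

Variables (K : nat) (rho : 'S_K.+1).

(** [inl u] is the class of x_u, and [inr (a, b)] the class of w_(a,b). *)
Definition label : finType := ('I_K.+1 + 'I_K.+1 * 'I_K.+1)%type.

(* Selection sort: step [t] moves the entry [rho t] to position [t], so that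
   [K] transpositions turn the identity into [rho]. *)
Fixpoint sorting (t : nat) : 'S_K.+1 :=
  if t is t'.+1 then
    (tperm (inord t') ((sorting t')^-1 (rho (inord t'))) * sorting t')%g
  else 1%g.

Definition source (t : nat) : 'I_K.+1 := ((sorting t)^-1)%g (rho (inord t)).

Lemma sortingS t u :
  sorting t.+1 u = sorting t (tperm (inord t) (source t) u).
Proof. by rewrite /= permM. Qed.

Lemma sorting_source t : sorting t (source t) = rho (inord t).
Proof. by rewrite /source permKV. Qed.

(** A later swap never disturbs a filled position [u]: it holds [rho u], so it cannot be the source
    of another entry. *)
Lemma sorting_prefix t : t <= K.+1 -> forall u : 'I_K.+1, u < t -> sorting t u = rho u.
Proof.
elim: t => // t IH ltK u; rewrite ltnS leq_eqVlt sortingS => /orP[/eqP ut|ut].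
  have <- : u = inord t by rewrite -ut inord_val.
  by rewrite tpermL /source -ut inord_val permKV.
have IHu := IH (ltnW ltK).
rewrite tpermD ?IHu //; apply/eqP=> e.
  by move: ut; rewrite -e inordK // ltnn.
have := sorting_source t; rewrite e IHu // => /perm_inj ue.
by move: ut; rewrite ue inordK // ltnn.
Qed.

(** The last entry needs no step: a permutation that agrees with [rho] at [K] of the [K.+1]
    positions equals [rho]. *)
Lemma sortingK : sorting K = rho.
Proof.
apply/permP=> u; have [uK|Ku] := ltnP u K; first by rewrite sorting_prefix.
have [v vE] : exists v, rho v = sorting K u by exists ((rho^-1)%g (sorting K u)); rewrite permKV.
have [vK|Kv] := ltnP v K.
  move: vE; rewrite -(sorting_prefix (leqnSn K) vK) => /perm_inj e.
  by move: vK; rewrite e ltnNge Ku.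
rewrite -vE; congr (rho _); apply: ord_inj.
by have := ltn_ord u; have := ltn_ord v; lia.
Qed.

Lemma sorting_end t : K <= t -> sorting t = rho.
Proof.
elim: t => [|t IH]; first by rewrite leqn0 => /eqP e; rewrite -[in LHS]e sortingK.
rewrite leq_eqVlt => /orP[/eqP<-|Kt]; first exact: sortingK.
have {}IH := IH Kt; apply/permP=> u.
by rewrite sortingS /source IH permK tperm1 perm1.
Qed.

Lemma source_end t : K <= t -> source t = inord t.
Proof. by move=> Kt; rewrite /source sorting_end // permK. Qed.

Lemma inord_le_source t : (inord t : 'I_K.+1) <= source t.
Proof.
have [Kt|tK] := leqP K t; first by rewrite source_end.
have tK1 : t < K.+1 by rewrite ltnS ltnW.
rewrite leqNgt inordK //; apply/negP=> h.
have := sorting_source t; rewrite (sorting_prefix (ltnW tK1) h) => /perm_inj e.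
by move: h; rewrite e inordK // ltnn.
Qed.

(* Block [2 t] of the word spells [sorting t]; in block [2 t + 1] the auxiliary
   label [inr] stands in while the entries at positions [t] and [source t] are
   exchanged. *)
Definition block_letter (b : nat) (u : 'I_K.+1) : label :=
  let sg := sorting b./2 in let p := inord b./2 in let q := source b./2 in
  if odd b then
    if u == q then inl (sg p) else if u == p then inr (sg p, sg q) else inl (sg u)
  else inl (sg u).

Definition letter (i : nat) : label :=
  block_letter (i %/ K.+1) (inord (i %% K.+1)).

Definition pure (G : 'I_K.+1 -> label) :=
  exists tau : 'S_K.+1, forall u, G u = inl (tau u).

(** [tau p] is the missing core label. As it is one of the pair [ab], the auxiliary vertex completes
    the remaining [K] core vertices to an edge of the gadget. *)
Definition mixed (G : 'I_K.+1 -> label) :=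
  exists (tau : 'S_K.+1) (p : 'I_K.+1) (ab : 'I_K.+1 * 'I_K.+1),
    (tau p == ab.1) || (tau p == ab.2) /\
    forall u, G u = if u == p then inr ab else inl (tau u).

(** The latest letter at each cyclic position once [r] letters of block [b.+1] have been written;
    every window is a reordering of such a state. *)
Definition state (b r : nat) (u : 'I_K.+1) : label :=
  if r <= u then block_letter b u else block_letter b.+1 u.

Lemma stateP b r : pure (state b r) \/ mixed (state b r).
Proof.
rewrite /pure /mixed /state /block_letter /=.
have pq := inord_le_source b./2; rewrite uphalf_half.
case: (boolP (odd b)) => ob /=; rewrite ?add1n ?add0n.
(* Odd block being overwritten: the auxiliary label stays at [p], with [sg q] missing, until [sg q]
   is written there. *)
- set sg := sorting _; set p := inord _ in pq *; set q := source _ in pq *.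
  have E u : sorting b./2.+1 u = sg (tperm p q u) by rewrite sortingS.
  have [rp|pr] := leqP r p; last first.
    left; exists (sorting b./2.+1) => u; rewrite E.
    case: ifP => // ru; case: eqP => [->|uq]; first by rewrite tpermR.
    case: eqP => [e|up]; first by move: ru pr; rewrite e; lia.
    by rewrite tpermD //; apply/eqP/nesym.
  have [e|ne] := eqVneq p q.
    left; exists sg => u; rewrite E e tperm1 perm1.
    by case: eqP => [->|]; case: ifP.
  right; exists (sorting b./2.+1), p, (sg p, sg q); rewrite E tpermL eqxx orbT; split=> // u.
  rewrite E; case: (eqVneq u q) => [->|uq].
    by rewrite eq_sym (negbTE ne) tpermR if_same.
  case: eqP => [->|up]; first by rewrite rp.
  by rewrite tpermD ?if_same //; [apply/eqP/nesym|rewrite eq_sym].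
(* Even block being overwritten: the state is pure up to [p], then lacks [sg p] until position [q]
   is rewritten, then lacks [sg q]. The order uses [p <= q]; a trivial swap [p = q] stays pure. *)
- set sg := sorting _; set p := inord _ in pq *; set q := source _ in pq *.
  have E u : sorting b./2.+1 u = sg (tperm p q u) by rewrite sortingS.
  have [e|ne] := eqVneq p q.
    left; exists sg => u; rewrite e.
    by case: eqP => [->|]; case: ifP.
  have [rp|pr] := leqP r p.
    left; exists sg => u; case: ifP => // ru.
    by case: eqP => [e|_]; [|case: eqP => // e]; move: ru; rewrite e; lia.
  have [rq|qr] := leqP r q.
    right; exists sg, p, (sg p, sg q); rewrite eqxx; split=> // u.
    case: (eqVneq u q) => [->|uq]; first by rewrite rq eq_sym (negbTE ne).
    by case: eqP => [->|up]; [rewrite leqNgt pr|rewrite if_same].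
  right; exists (sorting b./2.+1), p, (sg p, sg q); rewrite E tpermL eqxx orbT; split=> // u.
  rewrite E; case: (eqVneq u q) => [->|uq].
    by rewrite leqNgt qr /= eq_sym (negbTE ne) tpermR.
  case: eqP => [->|up]; first by rewrite leqNgt pr.
  by rewrite tpermD ?if_same //; [apply/eqP/nesym|rewrite eq_sym].
Qed.

Definition window (i : nat) (t : 'I_K.+1) : label := letter (i + t).

Definition slot (i : nat) (t : 'I_K.+1) : 'I_K.+1 := inord ((i + t) %% K.+1).

Lemma slotE i t : slot i t = (i + t) %% K.+1 :> nat.
Proof. by rewrite inordK // ltn_mod. Qed.

Lemma slot_inj i : injective (slot i).
Proof.
move=> t t' /(congr1 val) /eqP; rewrite /= !slotE eqn_modDl !modn_small //.
by move/eqP/ord_inj.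
Qed.

Lemma window_state i t :
  window i t = state (i %/ K.+1) (i %% K.+1) (slot i t).
Proof.
rewrite /window /state /letter -/(slot i t) slotE.
set k := K.+1; set b := i %/ k; set r := i %% k.
have rk : r < k by rewrite ltn_mod.
have tk := ltn_ord t.
have iE : i + t = b * k + (r + t) by rewrite addnA -divn_eq.
rewrite iE modnMDl divnMDl //.
have [h|h] := ltnP (r + t) k.
  by rewrite modn_small // divn_small // addn0 leq_addr.
have e : (r + t) %% k = r + t - k.
  by rewrite -[in LHS](subnK h) modnDr modn_small //; lia.
have -> : (r + t) %/ k = 1.
  by rewrite -[in LHS](subnK h) divnDr // divnn divn_small //; lia.
by rewrite e addn1; case: leqP => //; lia.
Qed.

Lemma windowP i : pure (window i) \/ mixed (window i).
Proof.
pose sl := perm (@slot_inj i).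
have [[tau h]|[tau [p [ab [hp h]]]]] := stateP (i %/ K.+1) (i %% K.+1).
  by left; exists (sl * tau)%g => t; rewrite window_state h permM permE.
right; exists (sl * tau)%g, ((sl^-1)%g p), ab; rewrite permM permKV; split=> // t.
have e : slot i t = sl t by rewrite permE.
by rewrite window_state h permM e -[in RHS](inj_eq (@perm_inj _ sl)) permKV.
Qed.

Lemma letter_start i : i < K.+1 -> letter i = inl (inord i).
Proof. by move=> h; rewrite /letter divn_small // modn_small // /block_letter /= perm1. Qed.

(** Sorting takes [K] steps of two blocks each, and each block has [K.+1] letters; from then on the
    word is periodic. *)
Lemma letter_end i : 2 * K * K.+1 <= i -> letter i = inl (rho (inord (i %% K.+1))).
Proof.
move=> h; rewrite /letter /block_letter.
have Kh : K <= (i %/ K.+1)./2.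
  have : 2 * K <= i %/ K.+1 by rewrite leq_divRL.
  by lia.
rewrite sorting_end // source_end //.
by case: odd => //; case: eqP => [->|].
Qed.

Lemma window_start_pure : pure (window 0).
Proof.
by exists 1%g => t; rewrite /window add0n letter_start // inord_val perm1.
Qed.

Lemma window_end_pure i : 2 * K * K.+1 <= i -> pure (window i).
Proof.
move=> h; exists (perm (@slot_inj i) * rho)%g => t.
by rewrite /window letter_end ?(leq_trans h) ?leq_addr // permM permE.
Qed.

End RotationWord.

Lemma pure_inj K (G : 'I_K.+1 -> label K) : pure G -> injective G.
Proof. by case=> tau h t t'; rewrite !h => -[/perm_inj]. Qed.

Lemma mixed_inj K (G : 'I_K.+1 -> label K) : mixed G -> injective G.
Proof.
case=> tau [p [ab [_ h]]] t t'; rewrite !h.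
by case: eqP => [->|_]; case: eqP => [->|_] // [/perm_inj].
Qed.

(** This [rho] makes the settled word read 0, 1, 2, ... again from index [s], so that it closes up
    cyclically. *)
Lemma exists_rotation K s : exists rho : 'S_K.+1,
  forall j, j < K.+1 -> rho (inord ((s + j) %% K.+1)) = inord j.
Proof.
exists ((perm (@slot_inj K s))^-1)%g => j jk.
apply: (@perm_inj _ (perm (@slot_inj K s))); rewrite permKV permE /slot.
by rewrite (inordK jk).
Qed.

(** * Gadgets at [v] and their positive density *)

Section Gadget.

Variables (K : nat) (T : finType) (H : {set {set T}}) (v : T).
Implicit Types phi psi : {ffun label K -> T}.

Definition nbr (S : {set T}) : {set T} := [set y | y |: S \in H].

(** An edge containing [S] has exactly one further vertex; this passes from counting edges to
    counting vertices. *)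
Lemma degree_nbr (S : {set T}) :
  is_kgraph K.+1 H -> #|S| = K -> degree H S <= #|nbr S|.
Proof.
move=> /forall_inP kH cS; rewrite /degree.
apply: leq_trans (leq_imset_card (fun y => y |: S) (mem (nbr S))).
apply/subset_leq_card/subsetP=> e; rewrite inE => /andP[eH Se].
have : 0 < #|e :\: S| by rewrite cardsDS // (eqP (kH _ eH)) cS subSnn.
case/card_gt0P=> y; rewrite inE => /andP[yS ye].
have eE : e = y |: S.
  apply/esym/eqP; rewrite eqEcard subUset sub1set ye Se /=.
  by rewrite cardsU1 yS cS (eqP (kH _ eH)).
by apply/imsetP; exists y; rewrite ?inE -?eE.
Qed.

Definition face phi (c : 'I_K.+1) : {set T} :=
  [set phi (inl u) | u in [set~ c]].

(** Injectivity and avoidance of [v] are included so that the classes of a box of gadgets are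
    automatically disjoint and miss [v]. *)
Definition gadget phi : bool :=
  [&& injectiveb phi, v \notin codom phi,
      phi (inl ord0) |: face phi ord0 \in H, v |: face phi ord0 \in H
    & [forall ab, (phi (inr ab) |: face phi ab.1 \in H)
                  && (phi (inr ab) |: face phi ab.2 \in H)]].

(** The order of choice: x_1, ..., x_K, then x_0, then the auxiliary vertices. *)
Definition rank (l : label K) : nat :=
  match l with
  | inl u => if u == ord0 then K else u.-1
  | inr ab => K.+1 + enum_rank ab
  end.

Lemma rank_inl (u : 'I_K.+1) : rank (inl u) <= K.
Proof. by rewrite /=; have := ltn_ord u; case: eqP => // _; lia. Qed.

Lemma rank_inj : injective rank.
Proof.
have ne0 (u : 'I_K.+1) : u <> ord0 -> 0 < u.
  by move=> h; rewrite lt0n; apply/eqP=> e; apply: h; apply: ord_inj.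
case=> [u|ab] [w|cd].
- rewrite /=; have := ltn_ord u; have := ltn_ord w.
  case: eqP => [->|/ne0 u0]; case: eqP => [->|/ne0 w0] //; rewrite /= => h1 h2 h3.
  + by lia.
  + by lia.
  + by congr inl; apply: ord_inj; lia.
- by move=> e; have := rank_inl u; rewrite e /= addSn leqNgt ltnS leq_addr.
- by move=> e; have := rank_inl w; rewrite -e /= addSn leqNgt ltnS leq_addr.
- by move=> /= /addnI /ord_inj /enum_rank_inj ->.
Qed.

(** Each edge condition is imposed at the vertex of that edge chosen last: x_K closes the edge
    through [v], x_0 the edge of core vertices. *)
Definition core (l : label K) phi : {set T} :=
  match l with
  | inl u =>
      if u == ord0 then nbr (face phi ord0)
      else if u == ord_max then
        nbr (v |: [set phi (inl w) | w in [set~ ord0] :\ ord_max])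
      else setT
  | inr ab => nbr (face phi ab.1) :&: nbr (face phi ab.2)
  end.

Definition candidates (l : label K) phi : {set T} :=
  core l phi :\: (v |: [set phi l' | l' in [set l' | rank l' < rank l]]).

Lemma rank_small (u : 'I_K.+1) : u != ord0 -> u != ord_max -> rank (inl u) < K.-1.
Proof.
move=> u0 um; rewrite /= (negbTE u0); have := ltn_ord u.
have : u != K :> nat by [].
have : u != 0 :> nat by [].
by lia.
Qed.

Lemma rank_ne0 (u : 'I_K.+1) : u != ord0 -> rank (inl u) < K.
Proof.
move=> u0; rewrite /= (negbTE u0); have := ltn_ord u.
have : u != 0 :> nat by [].
by lia.
Qed.

Lemma candidates_local l phi psi :
  (forall l', rank l' < rank l -> phi l' = psi l') ->
  candidates l phi = candidates l psi.
Proof.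
move=> h; rewrite /candidates; congr (_ :\: (_ |: _)); last first.
  by apply: eq_in_imset => l'; rewrite inE => /h.
case: l h => [u|ab] h; rewrite /core.
  case: eqP => [u0|/eqP u0].
    congr nbr; apply: eq_in_imset => w; rewrite !inE => w0; apply: h.
    by rewrite u0 [X in _ < X]/= rank_ne0.
  case: eqP => [um|//]; congr (nbr (_ |: _)); apply: eq_in_imset => w.
  rewrite !inE => /andP[wm w0]; apply: h.
  have -> : rank (inl u) = K.-1 by rewrite /= (negbTE u0) um.
  exact: rank_small.
have hi w : phi (inl w) = psi (inl w).
  by apply: h; rewrite [X in _ < X]/= addSn ltnS (leq_trans (rank_inl w)) ?leq_addr.
by congr (nbr _ :&: nbr _); apply: eq_in_imset => w _; exact: hi.
Qed.

(** Of two labels, the later one avoids the vertex of the earlier. The predicate [P] allows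
    partially admissible choices. *)
Lemma candidates_inj phi (P : pred (label K)) :
  (forall l, P l -> phi l \in candidates l phi) -> {in P &, injective phi}.
Proof.
move=> h; suff lt l l' : P l' -> rank l < rank l' -> phi l != phi l'.
  move=> l l' Pl Pl' e; apply: rank_inj; apply/eqP.
  rewrite eqn_leq leqNgt [X in _ && X]leqNgt; apply/andP; split; apply/negP=> hl.
    by have := lt _ _ Pl hl; rewrite e eqxx.
  by have := lt _ _ Pl' hl; rewrite e eqxx.
move=> Pl' hl; have := h l' Pl'; rewrite inE => /andP[+ _].
rewrite inE negb_or => /andP[_]; apply: contraNneq => <-.
by apply/imsetP; exists l; rewrite ?inE.
Qed.

Lemma candidates_neq phi l : phi l \in candidates l phi -> phi l != v.
Proof. by rewrite inE => /andP[+ _]; rewrite !inE negb_or => /andP[]. Qed.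

(** Each neighbourhood has at least [(1/2 + 1/(2q)) #|T|] vertices, so two of them share [#|T|/q].
    Excluding [v] and the earlier vertices costs at most half of that. *)
Lemma card_candidates (q : nat) l phi :
  0 < K -> 0 < q -> 2 * q * #|label K|.+1 <= #|T| -> is_kgraph K.+1 H ->
  (forall S : {set T}, #|S| = K -> q.+1 * #|T| <= 2 * q * degree H S) ->
  (forall l', rank l' < rank l -> phi l' \in candidates l' phi) ->
  #|T| <= 2 * q * #|candidates l phi|.
Proof.
move=> K0 q0 nT kH hdeg hphi.
have hn (S : {set T}) : #|S| = K -> q.+1 * #|T| <= 2 * q * #|nbr S|.
  move=> cS; apply: leq_trans (hdeg S cS) _.
  by rewrite leq_mul2l degree_nbr ?orbT.
have hn1 (S : {set T}) : #|S| = K -> #|T| <= q * #|nbr S| by move/hn; nia.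
have inj := candidates_inj hphi.
suff hcore : #|T| <= q * #|core l phi|.
  set E := v |: [set phi l' | l' in [set l' | rank l' < rank l]].
  have cE : #|E| <= #|label K|.+1.
    rewrite cardsU1 -[X in _ <= X]add1n leq_add ?leq_b1 //.
    by apply: leq_trans (leq_imset_card _ _) (max_card _).
  have : #|core l phi| <= #|candidates l phi| + #|E|.
    by rewrite -(cardsID E (core l phi)) addnC leq_add2l subset_leq_card ?subsetIr.
  by nia.
have card_face c : (forall u, u != c -> rank (inl u) < rank l) -> #|face phi c| = K.
  move=> hc; rewrite card_in_imset ?cardsC1 ?card_ord // => u w.
  by rewrite !inE => /hc hu /hc hw /inj e; case: (e hu hw).
case: l hphi inj card_face => [u|ab] hphi inj card_face; rewrite /core.
  case: eqP => [u0|/eqP u0].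
    by apply: hn1; apply: card_face => w w0; rewrite u0 [X in _ < X]/= rank_ne0.
  case: eqP => [um|_]; last by rewrite cardsT leq_pmull.
  have rE : rank (inl u) = K.-1 by rewrite /= (negbTE u0) um.
  apply: hn1; rewrite cardsU1 card_in_imset; last first.
    move=> w w'; rewrite !inE => /andP[wm w0] /andP[wm' w0'] e.
    have hw : rank (inl w) < rank (inl u) by rewrite rE rank_small.
    have hw' : rank (inl w') < rank (inl u) by rewrite rE rank_small.
    by case: (inj (inl w) (inl w') hw hw' e).
  have -> : #|[set~ ord0] :\ (ord_max : 'I_K.+1)| = K.-1.
    have := cardsD1 (ord_max : 'I_K.+1) [set~ ord0]; rewrite cardsC1 card_ord !inE.
    have -> : (ord_max : 'I_K.+1) != ord0 by rewrite -um.
    by rewrite /= add1n => /(congr1 predn) /= <-.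
  case: imsetP => [[w]|_]; last by rewrite add1n prednK.
  rewrite !inE => /andP[wm w0] vE.
  have hw : rank (inl w) < rank (inl u) by rewrite rE rank_small.
  by have := candidates_neq (hphi _ hw); rewrite -vE eqxx.
have hr w : rank (inl w) < rank (inr ab).
  by rewrite [X in _ < X]/= addSn ltnS (leq_trans (rank_inl w)) ?leq_addr.
have c1 := hn _ (card_face ab.1 (fun w _ => hr w)).
have c2 := hn _ (card_face ab.2 (fun w _ => hr w)).
have := congr1 (muln q) (cardsUI (nbr (face phi ab.1)) (nbr (face phi ab.2))).
have : #|nbr (face phi ab.1) :|: nbr (face phi ab.2)| <= #|T| := max_card _.
move=> /(leq_mul (leqnn q)); move: c1 c2.
move: #|_| #|_| #|_| #|_| #|_| => a b c d e; rewrite !mulnDr -!mulnA !mulSn.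
by lia.
Qed.

Lemma candidates_gadget phi :
  0 < K -> (forall l, phi l \in candidates l phi) -> gadget phi.
Proof.
move=> K0 h; have hc l : phi l \in core l phi by have := h l; rewrite inE => /andP[].
have m0 : (ord_max : 'I_K.+1) != ord0 by rewrite -(inj_eq val_inj) /= -lt0n.
apply/and5P; split.
- by apply/injectiveP=> l l'; apply: (@candidates_inj phi predT) => // ? _.
- by apply/codomP=> -[l e]; have := candidates_neq (h l); rewrite -e eqxx.
- by have := hc (inl ord0); rewrite /= inE.
- have := hc (inl ord_max); rewrite /core (negbTE m0) eqxx inE setUCA.
  have mC : ord_max \in [set~ (ord0 : 'I_K.+1)] by rewrite !inE.
  by rewrite /face -{2}(setD1K mC) imsetU1.
- by apply/forallP=> ab; have := hc (inr ab); rewrite /= !inE.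
Qed.

End Gadget.

Lemma many_gadgets (K q : nat) : 0 < K -> 0 < q ->
  exists Q N : nat, 0 < Q /\
    forall (T : finType) (H : {set {set T}}) (v : T),
      N <= #|T| -> is_kgraph K.+1 H ->
      (forall S : {set T}, #|S| = K -> q.+1 * #|T| <= 2 * q * degree H S) ->
      #|{ffun label K -> T}| <= Q * #|[set phi : {ffun label K -> T} | gadget H v phi]|.
Proof.
(* [J] exceeds every rank, so after [J] stages all labels have been treated. *)
move=> K0 q0; pose J := K.+1 + #|{: 'I_K.+1 * 'I_K.+1}|.
have q2 : 0 < 2 * q by rewrite muln_gt0.
exists ((2 * q) ^ J), (2 * q * #|label K|.+1); split; first by rewrite expn_gt0 q2.
move=> T H v nT kH hdeg.
have T0 : 0 < #|T| by apply/card_gt0P; exists v.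
apply: leq_trans (@greedy_count _ _ (@rank K) (@candidates K T H v) _ T0 q2 _ _ _ J) _.
- exact: rank_inj.
- exact: candidates_local.
- by move=> l phi; apply: card_candidates.
rewrite leq_mul2l; apply/orP; right; apply/subset_leq_card/subsetP=> phi.
rewrite !inE => /forallP h; apply: candidates_gadget => // l.
apply: (implyP (h l)); case: l => [u|ab].
  by apply: leq_ltn_trans (rank_inl u) _; rewrite /J addSn ltnS leq_addr.
by rewrite /J /= ltn_add2l ltn_ord.
Qed.

(** * Embedding the tight cycle into a box of gadgets *)

Lemma gadget_box_cycle (K s : nat) (T : finType) (H : {set {set T}}) (v : T)
    (S : label K -> {set T}) :
  2 * K.+1 ^ 2 <= s -> (forall l, #|S l| = s) ->
  (forall psi : {ffun label K -> T}, (forall l, psi l \in S l) -> gadget H v psi) ->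
  in_copy (tight_cycle K.+1 s) H v.
Proof.
move=> hs cS hS.
(* The extra [K.+1] letters ensure that a window wrapping past [s] starts only after the sorting is
   complete. *)
have hsK : 2 * K * K.+1 + K.+1 <= s by apply: leq_trans hs; rewrite -mulnn; nia.
have s0 : 0 < s by lia.
have [rho hrho] := exists_rotation K s; pose a := letter rho.
pose psi0 : {ffun label K -> T} := [ffun l => nth v (enum (S l)) 0].
have psi0S l : psi0 l \in S l by rewrite ffunE -mem_enum mem_nth // -cardE cS.
(* A common vertex of two classes could be used for both labels, against the injectivity of
   gadgets. *)
have disj l l' y : y \in S l -> y \in S l' -> l = l'.
  move=> yl yl'; pose psi := upd (upd psi0 l y) l' y.
  have psiS m : psi m \in S m.
    rewrite ffunE; case: eqP => [-> //|_].
    by rewrite ffunE; case: eqP => [-> //|_]; exact: psi0S.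
  have /and5P[/injectiveP inj _ _ _ _] := hS _ psiS.
  by apply: inj; rewrite !ffunE !eqxx if_same.
have vS l : v \notin S l.
  apply/negP=> vl; pose psi := upd psi0 l v.
  have psiS m : psi m \in S m by rewrite ffunE; case: eqP => [-> //|_]; exact: psi0S.
  have /and5P[_ /negP vc _ _ _] := hS _ psiS.
  by apply: vc; apply/codomP; exists l; rewrite updT.
(* Classes have size [s], so position [i] takes the [i]-th vertex of its class: equal labels at
   different positions get different vertices. *)
pose F i := nth v (enum (S (a i))) i.
have FS i : i < s -> F i \in S (a i) by move=> h; rewrite -mem_enum mem_nth // -cardE cS.
have F_inj i j : i < s -> j < s -> F i = F j -> i = j.
  move=> hi hj e; have aE : a i = a j.
    by apply: (disj _ _ (F i)); [|rewrite e]; apply: FS.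
  by apply/eqP; rewrite -(nth_uniq v _ _ (enum_uniq (S (a i)))) -?cardE ?cS //
    {2}aE; apply/eqP.
pose f : {ffun 'I_s -> T} := [ffun i : 'I_s => if i == 0 :> nat then v else F i].
apply/existsP; exists f; rewrite -andbA; apply/and3P; split.
- apply/injectiveP=> i j; rewrite !ffunE.
  case: eqP => [i0|_]; case: eqP => [j0|_].
  + by move=> _; apply: ord_inj; rewrite i0 j0.
  + by move=> e; have := vS (a j); rewrite e FS.
  + by move=> e; have := vS (a i); rewrite -e FS.
  + by move/F_inj => e; apply: ord_inj; apply: e.
- apply/forall_inP=> e /imsetP[i _ ->].
  pose idx (t : 'I_K.+1) := (i + t) %% s.
  have idxs t : idx t < s by rewrite ltn_mod.
  pose G := window rho i.
  have idx_big (t : 'I_K.+1) : s <= i + t -> idx t = i + t - s.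
    move=> h; rewrite /idx -[in LHS](subnK h) modnDr modn_small //.
    by have := ltn_ord i; have := ltn_ord t; lia.
  (* Past [s] the word continues as it began, by the choice of [rho], so cyclic windows are ordinary
     windows. *)
  have aG t : a (idx t) = G t.
    have [h|h] := ltnP (i + t) s; first by rewrite /idx modn_small.
    have jK : i + t - s < K.+1 by have := ltn_ord i; have := ltn_ord t; lia.
    rewrite idx_big // /a letter_start // /G /window letter_end; last by lia.
    by rewrite -[in RHS](subnKC h) hrho.
  have G_inj : injective G.
    by case: (windowP rho i) => [/pure_inj|/mixed_inj].
  (* A transversal through the vertices of this window, completed by [psi0] at the labels that do
     not occur in it; it is therefore a gadget. *)
  pose phi : {ffun label K -> T} :=
    [ffun l => if [pick t | G t == l] is Some t then F (idx t) else psi0 l].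
  have phiS l : phi l \in S l.
    by rewrite ffunE; case: pickP => [t /eqP <-|//]; rewrite -aG FS.
  have phiG t : phi (G t) = F (idx t).
    by rewrite ffunE; case: pickP => [t' /eqP /G_inj -> //|/(_ t)]; rewrite eqxx.
  have /and5P[_ _ pureH vH /forallP mixH] := hS _ phiS.
  have -> : f @: [set j : 'I_s | [exists t : 'I_K.+1, j == (i + t) %% s :> nat]]
         = [set if idx t == 0 then v else F (idx t) | t : 'I_K.+1].
    apply/setP=> y; apply/imsetP/imsetP => [[j]|[t _ ->]].
      rewrite inE => /existsP[t /eqP jE] ->; exists t => //.
      by rewrite ffunE jE.
    exists (Ordinal (idxs t)); last by rewrite ffunE.
    by rewrite inE; apply/existsP; exists t.
  (* A window through position 0 is the initial one or starts after the sorting, hence is pure; [v]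
     in place of x_0 then gives the gadget edge through [v]. *)
  have [/existsP[t0 /eqP z0]|no0] := boolP [exists t, idx t == 0].
    have [tau tauE] : pure G.
      have [i0|i0] := posnP i; first by rewrite /G i0; exact: window_start_pure.
      apply: window_end_pure; have := ltn_ord t0; have := ltn_ord i.
      have [h|h] := ltnP (i + t0) s; last by lia.
      by move: z0; rewrite /idx modn_small //; lia.
    have tau0 t : (idx t == 0) = (tau t == ord0).
      have t0E : tau t0 = ord0.
        have : G t0 = inl ord0.
          by rewrite -aG z0 /a letter_start //; congr inl; apply: ord_inj; rewrite inordK.
        by rewrite tauE => -[].
      apply/eqP/eqP => [h|]; last by rewrite -t0E => /perm_inj ->.
      have : G t = G t0 by rewrite -!aG h z0.
      by rewrite !tauE t0E => -[].
    move: vH; congr (_ \in H); apply/setP=> y; apply/setU1P/imsetP => [[->|]|[t _ ->]].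
    + by exists t0; rewrite ?z0.
    + case/imsetP=> u; rewrite !inE => u0 ->; exists ((tau^-1)%g u) => //.
      by rewrite tau0 permKV (negbTE u0) -phiG tauE permKV.
    + rewrite tau0; case: eqP => [|/eqP h]; [by left|right].
      by apply/imsetP; exists (tau t); rewrite ?inE // -phiG tauE.
  have -> : [set if idx t == 0 then v else F (idx t) | t : 'I_K.+1]
            = [set phi (G t) | t : 'I_K.+1].
    apply: eq_imset => t; rewrite phiG; case: eqP => // h.
    by case/existsP: no0; exists t; apply/eqP.
  case: (windowP rho i) => [[tau tauE]|[tau [p [ab [pab tauE]]]]].
    move: pureH; congr (_ \in H); apply/setP=> y; apply/setU1P/imsetP => [h|[t _ ->]].
      have [u ->] : exists u, y = phi (inl u).
        by case: h => [->|/imsetP[u _ ->]]; [exists ord0|exists u].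
      by exists ((tau^-1)%g u); rewrite // /G tauE permKV.
    rewrite /G tauE; have [->|h] := eqVneq (tau t) ord0; [by left|right].
    by apply/imsetP; exists (tau t); rewrite ?inE.
  have cH : phi (inr ab) |: face phi (tau p) \in H.
    by have /andP[m1 m2] := mixH ab; case/orP: pab => /eqP ->.
  move: cH; congr (_ \in H); apply/setP=> y; apply/setU1P/imsetP => [[->|]|[t _ ->]].
  + by exists p; rewrite // /G tauE eqxx.
  + case/imsetP=> u; rewrite !inE => u0 ->; exists ((tau^-1)%g u); rewrite // /G tauE permKV.
    by case: eqP => // h; move: u0; rewrite -h permKV eqxx.
  + rewrite /G tauE; case: eqP => [_|/eqP h]; [by left|right].
    by apply/imsetP; exists (tau t); rewrite // !inE (inj_eq perm_inj).
- by apply/codomP; exists (Ordinal s0); rewrite ffunE.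
Qed.

(** * Assembly, and passage to real [gamma] *)

Lemma tight_cycle_covering_nat (k s q : nat) :
  2 <= k -> 2 * k ^ 2 <= s -> 0 < q ->
  exists N : nat, forall (T : finType) (H : {set {set T}}),
    N <= #|T| -> is_kgraph k H ->
    (forall S : {set T}, #|S| = k.-1 -> q.+1 * #|T| <= 2 * q * degree H S) ->
    forall v : T, in_copy (tight_cycle k s) H v.
Proof.
case: k => // K hk hs q0.
have s0 : 0 < s by apply: leq_trans hs; rewrite muln_gt0 expn_gt0.
have [Q [N1 [Q0 gad]]] := many_gadgets (K := K) hk q0.
have [N2 box] := dense_ffun_box (label K) Q0 s0.
exists (maxn N1 N2) => T H; rewrite geq_max => /andP[n1 n2] kH hdeg v.
have T0 : 0 < #|T| by apply/card_gt0P; exists v.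
have [S [cS hS]] := box T _ T0 n2 (gad T H v n1 kH hdeg).
by apply: (gadget_box_cycle hs cS) => psi /hS; rewrite inE.
Qed.

Lemma min_degree_le (i : nat) (T : finType) (H : {set {set T}}) (S : {set T}) :
  #|S| = i -> min_degree i H <= degree H S.
Proof.
move=> cS; rewrite /min_degree.
have : S \in index_enum {set T} by rewrite mem_index_enum.
elim: (index_enum _) => // A r IH; rewrite inE big_cons => /orP[/eqP <-|/IH h].
  by rewrite cS eqxx geq_minl.
by case: ifP => // _; rewrite geq_min h orbT.
Qed.

Import Order.TTheory GRing.Theory Num.Theory.
Local Open Scope ring_scope.

Theorem theorem1p3 (R : realType) (k s : nat) (hk : (2 <= k)%N)
    (hs : (2 * k ^ 2 <= s)%N) (gamma : R) (hgamma : 0 < gamma) :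
  exists n0 : nat, forall n : nat, (n0 <= n)%N ->
    (covering_threshold k k.-1 n (tight_cycle k s))%:R
      <= (1 / 2 + gamma) * n%:R
    /\
    (forall (T : finType) (H : {set {set T}}),
        #|T| = n -> is_kgraph k H ->
        (1 / 2 + gamma) * n%:R < (min_degree k.-1 H)%:R ->
        forall v : T, in_copy (tight_cycle k s) H v).
Proof.
(* As [1/q <= gamma], degrees of at least [(1/2 + gamma) n] exceed the integral bound
   [(1/2 + 1/(2q)) n]. *)
pose q := (Num.truncn gamma^-1).+1.
have qg : 1 <= q%:R * gamma.
  have := truncnS_gt gamma^-1; rewrite -/q => h.
  by rewrite -ler_pdivrMr // div1r ltW.
have [N cyc] := tight_cycle_covering_nat hk hs (ltn0Sn _ : 0 < q)%N.
exists N => n Nn.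
suff cov : forall (T : finType) (H : {set {set T}}),
    #|T| = n -> is_kgraph k H ->
    (1 / 2 + gamma) * n%:R < (min_degree k.-1 H)%:R ->
    forall v : T, in_copy (tight_cycle k s) H v.
  split=> //; rewrite /covering_threshold.
  (* The bound holds for the default value 0, passes to maxima, and holds for every [H] without a
     covering by contraposition of [cov]. *)
  apply: (big_ind (fun d : nat => d%:R <= (1 / 2 + gamma) * n%:R)).
  - by rewrite mulr_ge0 //; lra.
  - by move=> x y hx hy; rewrite /maxn; case: ifP.
  - move=> H /andP[kH nocov]; rewrite leNgt; apply: contra nocov => h.
    by apply/forallP=> v; apply: (cov _ H (card_ord n) kH h).
move=> T H cT kH hd; apply: cyc => //; first by rewrite cT.
move=> S cS; rewrite cT.
have hS : (1 / 2 + gamma) * n%:R <= (degree H S)%:R :> R.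
  by apply: le_trans (ltW hd) _; rewrite ler_nat min_degree_le.
rewrite -(ler_nat R) !natrM -[q.+1]add1n natrD.
have qn0 : 0 <= q%:R :> R by [].
have nn0 : 0 <= n%:R :> R by [].
have := ler_wpM2r nn0 qg; have := ler_wpM2l qn0 hS.
nra.
Qed.
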